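(* It is not true that, for every bounded function $m:\mathbb{Z}\times\mathbb{Z}\to\mathbb{C}$ for which there is a constant $C$ with $$\sum_{2^{n-1}\le |k|<2^{n}}|m(k+j+1,j)-m(k+j,j)|<C\qquad\text{for all } n\in\mathbb{N},\ j\in\mathbb{Z},$$ the Schur multiplier $M_m$ extends to a bounded map on the Schatten class $S^p$ for all $1<p<\infty$. Likewise, it is not true that, for every bounded function $m:\mathbb{Z}\times\mathbb{Z}\to\mathbb{C}$ for which there is a constant $C$ with $$\sum_{2^{n-1}\le |k|<2^{n}}|m(j,k+j+1)-m(j,k+j)|<C\qquad\text{for all } n\in\mathbb{N},\ j\in\mathbb{Z},$$ the Schur multiplier $M_m$ extends to a bounded map on $S^p$ for all $1<p<\infty$.
   Context: Operators on a Hilbert space with orthonormal basis indexed by $\mathbb{Z}$ (e.g. $\ell^2(\mathbb{Z})$) are written as matrices $(a_{k,j})_{k,j\in\mathbb{Z}}$. For a bounded function $m$ on $\mathbb{Z}\times\mathbb{Z}$ the Schur multiplier with symbol $m$ is $M_m:(a_{k,j})\mapsto(m(k,j)a_{k,j})$, which is bounded on the Hilbert–Schmidt class $S^2$. $S^p$ is the Schatten class with norm $\|A\|_p=(\mathrm{tr}[(A^*A)^{p/2}])^{1/p}$. ''Extends to a bounded map on $S^p$'' means that $M_m$, defined on $S^2\cap S^p$, extends to a bounded operator $S^p\to S^p$. *)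

(* Defs.v *)
From mathcomp Require Import all_boot all_order all_algebra.
From mathcomp Require Import complex.
From mathcomp Require Import all_classical all_reals all_analysis.

Set Implicit Arguments.
Unset Strict Implicit.
Unset Printing Implicit Defensive.
Import Order.TTheory GRing.Theory Num.Theory.
Import numFieldNormedType.Exports.

Local Open Scope classical_set_scope.
Local Open Scope ring_scope.

(* Real-valued modulus of a complex number (`|z| on R[i] has values in R[i]). *)
Notation cabs := ComplexField.Normc.normc.

Section Schatten.
Variable R : realType.
Local Notation C := R[i].

(* Operators on l^2(Z) are identified with their matrices in the standard
   basis: the entry (k, j) of A is <A e_j, e_k>. *)
Definition opmx : Type := int -> int -> C.

Definition rsum (f : int -> R) : R :=
  fine (\esum_(k in [set: int]) (EFin \o f)^\+ k
        - \esum_(k in [set: int]) (EFin \o f)^\- k)%E.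

(* Sum of an absolutely summable family over Z; the value is irrelevant for
   other families. *)
Definition csum (x : int -> C) : C :=
  Complex (rsum (fun k => complex.Re (x k))) (rsum (fun k => complex.Im (x k))).

Definition l2norm (x : int -> C) : \bar R :=
  ((\esum_(k in [set: int]) (cabs (x k) ^+ 2)%:E) `^ 2^-1)%E.

Definition opmx_app (A : opmx) (x : int -> C) : int -> C :=
  fun k => csum (fun j => A k j * x j).

Definition opnorm (A : opmx) : \bar R :=
  ereal_sup [set l2norm (opmx_app A x) | x in [set x | (l2norm x <= 1)%E]].

(* A is the matrix of a bounded operator on l^2(Z); the first clause makes the
   sums in opmx_app genuine. *)
Definition bounded_op (A : opmx) : Prop :=
  (forall x, (l2norm x < +oo)%E -> forall k,
     summable [set: int] (fun j => (cabs (A k j * x j))%:E)) /\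
  (opnorm A < +oo)%E.

Definition opmx1 : opmx := fun k j => (k == j)%:R.

Definition opmx_mul (A B : opmx) : opmx :=
  fun k j => csum (fun l => A k l * B l j).

Definition opmx_adj (A : opmx) : opmx := fun k j => conjc (A j k).

Definition opmx_pow (B : opmx) (n : nat) : opmx := iter n (opmx_mul B) opmx1.

Definition opmx_horner (B : opmx) (q : {poly R}) : opmx :=
  fun k j => \sum_(i < size q) real_complex R q`_i * opmx_pow B i k j.

(* Continuous functional calculus for a bounded positive operator B, whose
   spectrum lies in [0, ||B||]: f(B) is the limit in operator norm of q_n(B),
   where the polynomials q_n tend to f uniformly on [0, ||B||]; it does not
   depend on the choice of the q_n. *)
Definition is_funcalc (f : R -> R) (B D : opmx) : Prop :=
  bounded_op D /\
  exists q : nat -> {poly R},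
    {uniform `[0, fine (opnorm B)], (fun n t => (q n).[t]) @ \oo --> f} /\
    opnorm (fun k j => opmx_horner B (q n) k j - D k j) @[n --> \oo] --> 0%E.

Definition funcalc (f : R -> R) (B : opmx) : opmx :=
  xget (fun _ _ => 0) [set D | is_funcalc f B D].

(* Only meaningful for positive operators, whose diagonal entries are
   nonnegative reals. *)
Definition optrace (D : opmx) : \bar R :=
  \esum_(k in [set: int]) (complex.Re (D k k))%:E.

Definition schatten_norm (p : R) (A : opmx) : \bar R :=
  (optrace (funcalc (fun t => powR t (p / 2)) (opmx_mul (opmx_adj A) A))
     `^ p^-1)%E.

(* Compactness of A is a consequence of the finiteness of the norm. *)
Definition schatten (p : R) (A : opmx) : Prop :=
  bounded_op A /\ (schatten_norm p A < +oo)%E.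

Definition schur_mul (m : int -> int -> C) (A : opmx) : opmx :=
  fun k j => m k j * A k j.

(* Outside S^p the values of T are irrelevant. *)
Definition schur_extends (p : R) (m : int -> int -> C) : Prop :=
  exists T : opmx -> opmx,
    [/\ forall A, schatten p A -> schatten p (T A),
        forall (a : C) A B, schatten p A -> schatten p B ->
          T (fun k j => a * A k j + B k j)
          = (fun k j => a * T A k j + T B k j),
        exists K : R, forall A, schatten p A ->
          (schatten_norm p (T A) <= K%:E * schatten_norm p A)%E
      & forall A, schatten 2 A -> schatten p A -> T A = schur_mul m A].

Definition bounded_symbol (m : int -> int -> C) : Prop :=
  exists M : R, forall k j, cabs (m k j) <= M.

(* Since 0.-1 = 0, the block of index n = 0 is empty, in accordance with
   2^(-1) <= |k| < 1 having no integer solution. *)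
Definition dyadic (n : nat) : set int :=
  [set k : int | (2 ^ n.-1 <= `|k| < 2 ^ n)%N].

End Schatten.

(* Main.v *)
Require Import Defs.
From mathcomp Require Import all_boot all_order all_algebra.
From mathcomp Require Import complex.
From mathcomp Require Import all_classical all_reals all_analysis.
From mathcomp Require Import ring lra zify.
Set Implicit Arguments.
Unset Strict Implicit.
Unset Printing Implicit Defensive.
Import Order.TTheory GRing.Theory Num.Theory.
Import numFieldNormedType.Exports.
Local Open Scope classical_set_scope.
Local Open Scope ring_scope.

(* The symbol is a sign which is -1 exactly at the entries (2^e, j), j >= 0, for
   which the j-th binary digit of e is 1.  Such entries have j < 2^(e-1), so
   each dyadic shell around a column j meets at most a bounded number of rows
   2^e, and the variations are bounded by an absolute constant.  On the rows
   2^e (e < 2^d) and the columns 0 <= j < d the symbol is a 2^d x d matrix of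
   signs E with orthogonal columns, E^* E = 2^d, whereas the multiplier maps E
   to the all-ones matrix J.  Since ||E||_4^4 = 4^d d and ||J||_4^4 = 4^d d^2,
   the multiplier is unbounded on S^4.  Transposing gives the other half. *)

(** * Sums, vectors and matrices of finite support *)

Section FiniteSupport.
Variable R : realType.
Local Notation C := R[i].

Lemma esum_finsupp (s : seq int) (f : int -> \bar R) : uniq s ->
  (forall k, (0 <= f k)%E) -> (forall k, k \notin s -> f k = 0%E) ->
  \esum_(k in [set: int]) f k = (\sum_(k <- s) f k)%E.
Proof.
move=> us f0 fs.
transitivity (\esum_(k in [set` s]) f k).
  rewrite [RHS]esum_mkcond; apply: eq_esum => k _.
  by case: ifPn => //; rewrite mem_setE => /fs.
rewrite [RHS]fsbig_seq// esum_fset//; exact: finite_seq.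
Qed.

Lemma rsum_finsupp (s : seq int) (f : int -> R) : uniq s ->
  (forall k, k \notin s -> f k = 0) -> rsum f = \sum_(k <- s) f k.
Proof.
move=> us fs; rewrite /rsum !(@esum_finsupp s)//.
- under [X in (X - _)%E]eq_bigr do rewrite funeposE /= -EFin_max.
  under [X in (_ - X)%E]eq_bigr do rewrite funenegE /= -EFin_max.
  rewrite !sumEFin -EFinB /= -sumrB; apply: eq_bigr => k _.
  by rewrite /Order.max; case: ifPn; case: ifPn; lra.
- by move=> k /fs fk; rewrite funenegE /= fk oppr0 maxxx.
- by move=> k /fs fk; rewrite funeposE /= fk maxxx.
Qed.

Lemma csum_finsupp (s : seq int) (x : int -> C) : uniq s ->
  (forall k, k \notin s -> x k = 0) -> csum x = \sum_(k <- s) x k.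
Proof.
move=> us xs; rewrite /csum !(@rsum_finsupp s)//.
- by apply/eqP; rewrite eq_complex /= !raddf_sum !eqxx.
- by move=> k /xs ->.
- by move=> k /xs ->.
Qed.

Lemma l2norm_finsupp (s : seq int) (x : int -> C) : uniq s ->
  (forall k, k \notin s -> x k = 0) ->
  l2norm x = ((\sum_(k <- s) cabs (x k) ^+ 2) `^ 2^-1)%:E.
Proof.
move=> us xs; rewrite /l2norm (@esum_finsupp s) ?sumEFin//.
  by move=> k; rewrite lee_fin sqr_ge0.
by move=> k /xs ->; rewrite ComplexField.Normc.normc0 expr0n.
Qed.

Lemma cabs_ge0 (z : C) : 0 <= cabs z.
Proof. by case: z => a b; exact: sqrtr_ge0. Qed.

Lemma cabs_sum (s : seq int) (x : int -> C) :
  cabs (\sum_(k <- s) x k) <= \sum_(k <- s) cabs (x k).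
Proof.
elim/big_ind2: _ => [|x1 y1 x2 y2 h1 h2|//].
  by rewrite ComplexField.Normc.normc0.
by rewrite (le_trans (le_normcD _ _))// lerD.
Qed.

Lemma cabs_le_l2norm (x : int -> C) k : ((cabs (x k))%:E <= l2norm x)%E.
Proof.
rewrite /l2norm.
have -> : cabs (x k) = (cabs (x k) ^+ 2) `^ 2^-1.
  by rewrite powR12_sqrt ?sqr_ge0// sqrtr_sqr ger0_norm ?cabs_ge0.
rewrite -poweR_EFin; apply: gt0_ler_poweR; rewrite ?invr_ge0//.
- by rewrite in_itv /= leey andbT lee_fin sqr_ge0.
- by rewrite in_itv /= leey andbT esum_ge0// => i _; rewrite lee_fin sqr_ge0.
apply: esum_ge; exists [set k]; first by split => //; exact: finite_set1.
by rewrite fsbig_set1.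
Qed.

Lemma opmx_app_delta (E : opmx R) j k :
  opmx_app E (fun l => (l == j)%:R) k = E k j.
Proof.
rewrite /opmx_app (@csum_finsupp [:: j])// ?big_seq1 ?eqxx ?mulr1//.
by move=> l; rewrite inE => /negbTE ->; rewrite mulr0.
Qed.

Lemma l2norm_delta j : l2norm (fun l => (l == j)%:R : C) = 1%E.
Proof.
rewrite (@l2norm_finsupp [:: j])// => [|l]; last by rewrite inE => /negbTE ->.
by rewrite big_seq1 eqxx ComplexField.Normc.normc1 expr1n powR1.
Qed.

(** Each entry is a coordinate of the image of a unit basis vector; hence convergence in operator
    norm implies entrywise convergence. *)
Lemma cabs_le_opnorm (E : opmx R) k j : ((cabs (E k j))%:E <= opnorm E)%E.
Proof.
rewrite -opmx_app_delta; apply: (le_trans (cabs_le_l2norm _ _)).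
apply: ereal_sup_ubound; exists (fun l => (l == j)%:R) => //=.
by rewrite l2norm_delta.
Qed.

Lemma opnorm0 : opnorm (fun _ _ => 0 : C) = 0%E.
Proof.
have app0 x : l2norm (opmx_app (fun _ _ => 0 : C) x) = 0%E.
  rewrite (@l2norm_finsupp [::])// ?big_nil ?powR0// => k _.
  by rewrite /opmx_app (@csum_finsupp [::]) ?big_nil// => j _; rewrite mul0r.
apply/eqP; rewrite eq_le; apply/andP; split.
  by apply: ge_ereal_sup => _ [x _ <-]; rewrite app0.
by rewrite -{1}(app0 (fun _ => 0)); apply: ereal_sup_ubound;
  exists (fun _ => 0) => //=; rewrite (@l2norm_finsupp [::])// big_nil powR0.
Qed.

Definition supported (s t : seq int) (A : opmx R) :=
  forall k j, ~~ ((k \in s) && (j \in t)) -> A k j = 0.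

Lemma opmx_app_supported s t (A : opmx R) x k : uniq t -> supported s t A ->
  opmx_app A x k = \sum_(j <- t) A k j * x j.
Proof.
move=> ut sA; apply: csum_finsupp => // j jt.
by rewrite sA ?mul0r// (negbTE jt) andbF.
Qed.

Lemma opmx_app_notin s t (A : opmx R) x k : uniq t -> supported s t A ->
  k \notin s -> opmx_app A x k = 0.
Proof.
move=> ut sA ks; rewrite (opmx_app_supported _ _ ut sA) big1// => j _.
by rewrite sA ?mul0r// (negbTE ks).
Qed.

Lemma bounded_op_supported s t (A : opmx R) : uniq s -> uniq t ->
  supported s t A -> bounded_op A.
Proof.
move=> us ut sA; split.
  move=> x _ k; rewrite /summable (@esum_finsupp t)//.
    by under eq_bigr do rewrite abse_EFin; rewrite sumEFin ltry.
  move=> j jt; rewrite sA ?mul0r ?(negbTE jt) ?andbF//.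
  by rewrite ComplexField.Normc.normc0 abse0.
(* Coordinates of a vector in the unit ball have modulus at most 1, so coordinate [k] of its image
   is at most the sum of the moduli in row [k]. *)
apply: (@le_lt_trans _ _
  ((\sum_(k <- s) (\sum_(j <- t) cabs (A k j)) ^+ 2) `^ 2^-1)%:E); last exact: ltry.
apply: ge_ereal_sup => _ [x /= x1 <-].
rewrite (@l2norm_finsupp s)//; last by move=> k; exact: (opmx_app_notin _ ut sA).
rewrite lee_fin; apply: ge0_ler_powR; rewrite ?invr_ge0 ?nnegrE//.
- by apply: sumr_ge0 => k _; exact: sqr_ge0.
- by apply: sumr_ge0 => k _; exact: sqr_ge0.
apply: ler_sum => k _; rewrite ler_pXn2r// ?nnegrE ?cabs_ge0 ?sumr_ge0//; last first.
  by move=> j _; exact: cabs_ge0.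
rewrite (opmx_app_supported _ _ ut sA) (le_trans (cabs_sum _ _))// ler_sum// => j _.
rewrite ComplexField.Normc.normcM ler_piMr ?cabs_ge0//.
by rewrite -lee_fin (le_trans (cabs_le_l2norm _ _)).
Qed.

Lemma l2normZ s (a : R) (x : int -> C) : uniq s -> 0 <= a ->
  (forall k, k \notin s -> x k = 0) ->
  l2norm (fun k => a%:C%C * x k) = (a%:E * l2norm x)%E.
Proof.
move=> us a0 xs; rewrite !(@l2norm_finsupp s)//; last first.
  by move=> k /xs ->; rewrite mulr0.
rewrite -EFinM; congr (_%:E).
have -> : \sum_(k <- s) cabs (a%:C%C * x k) ^+ 2
    = a ^+ 2 * \sum_(k <- s) cabs (x k) ^+ 2.
  rewrite mulr_sumr; apply: eq_bigr => k _.
  by rewrite ComplexField.Normc.normcM exprMn {1}/cabs /= expr0n addr0 sqrtr_sqr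
    real_normK ?num_real.
rewrite powRM ?sqr_ge0 ?sumr_ge0//; last by move=> k _; exact: sqr_ge0.
by rewrite powR12_sqrt ?sqr_ge0// sqrtr_sqr ger0_norm.
Qed.

Lemma opnorm_ge_eigen s t (A : opmx R) (c : R) (v : int -> C) j :
  uniq s -> uniq t -> supported s t A ->
  (forall k, k \notin t -> v k = 0) -> v j != 0 -> 0 <= c ->
  (forall k, opmx_app A v k = c%:C%C * v k) -> (c%:E <= opnorm A)%E.
Proof.
move=> us ut sA vt vj c0 Av.
have [N lN] : exists N : R, l2norm v = N%:E.
  by rewrite (@l2norm_finsupp t)//; eexists.
have N0 : 0 < N.
  rewrite -lte_fin -lN (lt_le_trans _ (cabs_le_l2norm v j))// lte_fin lt_def cabs_ge0 andbT.
  by apply: contra vj => /eqP/ComplexField.Normc.eq0_normc ->.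
have xE : l2norm (fun k => (N^-1)%:C%C * v k) = 1%E.
  by rewrite (@l2normZ t)// ?invr_ge0 ?(ltW N0)// lN -EFinM mulVf// gt_eqF.
apply: ereal_sup_ubound; exists (fun k => (N^-1)%:C%C * v k); rewrite /= ?xE//.
have -> : opmx_app A (fun k => (N^-1)%:C%C * v k)
    = fun k => c%:C%C * ((N^-1)%:C%C * v k).
  apply/funext => k; rewrite mulrCA -Av !(opmx_app_supported _ _ ut sA) mulr_sumr.
  by apply: eq_bigr => l _; rewrite mulrCA.
rewrite (@l2normZ t)// ?xE ?mule1// => k /vt ->; by rewrite mulr0.
Qed.
End FiniteSupport.

(** * Functional calculus of a finite matrix with B^2 = c B *)

Section FunctionalCalculus.
Variable R : realType.
Local Notation C := R[i].
Variables (t : seq int) (B : opmx R) (c : R).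
Hypotheses (ut : uniq t) (sB : supported t t B) (c0 : 0 < c).
Hypothesis BB : forall k j, \sum_(l <- t) B k l * B l j = c%:C%C * B k j.

Lemma opmx_pow_quasi_idem i k j : opmx_pow B i.+1 k j = (c ^+ i)%:C%C * B k j.
Proof.
elim: i k j => [|i IH] k j; rewrite /opmx_pow iterS.
  rewrite expr0 mul1r /opmx_mul (@csum_finsupp _ [:: j])//=.
    by rewrite big_seq1 /opmx1 eqxx mulr1.
  by move=> l; rewrite inE /opmx1 => /negbTE ->; rewrite mulr0.
rewrite /opmx_mul (@csum_finsupp _ t)//; last first.
  by move=> l lt; rewrite sB ?mul0r// (negbTE lt) andbF.
transitivity (\sum_(l <- t) (c ^+ i)%:C%C * (B k l * B l j)).
  by apply: eq_bigr => l _; rewrite -/(opmx_pow B i.+1) IH mulrCA.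
by rewrite -mulr_sumr BB mulrA -rmorphM -exprSr.
Qed.

(** The zeroth power is the identity, which is not a multiple of [B] and is kept apart with
    coefficient q(0). The coefficient of degree i > 0 is multiplied by c^(i-1), and these products
    sum to (q(c) - q(0)) / c. *)
Lemma opmx_horner_quasi_idem (q : {poly R}) k j : opmx_horner B q k j =
  (q.[0])%:C%C * (k == j)%:R + ((q.[c] - q.[0]) / c)%:C%C * B k j.
Proof.
(* This serves as a case split that isolates the constant term. *)
elim/poly_ind: q => [|q a _].
  by rewrite /opmx_horner size_poly0 big_ord0 !horner0 subrr mul0r !mul0r addr0.
set q' := q * 'X + a%:P.
(* The range is extended to a uniform length, since [q'] has size 0 when [q] and [a] both vanish. *)
have E : opmx_horner B q' k j = \sum_(i < (size q).+1) (q'`_i)%:C%C * opmx_pow B i k j.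
  have sq : (size q' <= (size q).+1)%N.
    by rewrite size_MXaddC; case: ifP.
  rewrite /opmx_horner -(big_mkord xpredT (fun i => (q'`_i)%:C%C * opmx_pow B i k j)).
  rewrite -(big_mkord xpredT (fun i => (q'`_i)%:C%C * opmx_pow B i k j)).
  rewrite [RHS](@big_cat_nat _ _ _ (size q'))//= [X in _ + X]big1_seq ?addr0//.
  move=> i; rewrite mem_index_iota => /andP[_ /andP[iq _]].
  by rewrite nth_default// rmorph0 mul0r.
rewrite E big_ord_recl.
have -> : q'`_ord0 = q'.[0].
  by rewrite horner_coef0.
congr (_ + _).
under eq_bigr do rewrite lift0 opmx_pow_quasi_idem mulrA -rmorphM.
rewrite -mulr_suml -rmorph_sum; congr (_%:C%C * _).
rewrite /q' !hornerE addrK mulfK ?gt_eqF// horner_coef.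
by apply: eq_bigr => i _; rewrite coefD coefMX coefC /= addr0.
Qed.

Hypothesis Bn0 : exists k j, B k j != 0.

(** A nonzero column of [B] is an eigenvector for [c], because B B = c B. *)
Lemma opnorm_ge_quasi_idem : (c%:E <= opnorm B)%E.
Proof.
have [k [j Bkj]] := Bn0.
apply: (@opnorm_ge_eigen _ t t B c (fun k => B k j) k) => //.
- by move=> l lt; rewrite sB// (negbTE lt).
- exact: ltW.
- by move=> l; rewrite (opmx_app_supported _ _ ut sB) BB.
Qed.

(* Since B^2 = c B, a polynomial q(B) depends only on q(0) and q(c); as
   0 <= c <= ||B||, uniform approximation of f on [0, ||B||] pins down f(B)
   without any spectral theory. *)
Lemma funcalc_quasi_idem (f : R -> R) (q : {poly R}) :
  (forall x, 0 <= x -> f x = q.[x]) -> f 0 = 0 ->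
  funcalc f B = fun k j => (f c / c)%:C%C * B k j.
Proof.
move=> fq f0; have bB := bounded_op_supported ut ut sB.
have cB : c <= fine (opnorm B).
  have oB : opnorm B \is a fin_num.
    by rewrite ge0_fin_numE ?bB.2// (le_trans _ opnorm_ge_quasi_idem)// lee_fin ltW.
  by rewrite -lee_fin fineK// opnorm_ge_quasi_idem.
set D0 := fun k j => _.
have D0P : is_funcalc f B D0.
  split.
    apply: (@bounded_op_supported _ t t) => // k j kj.
    by rewrite /D0 sB// mulr0.
  (* As [f] agrees with [q] on [0, +oo), a constant sequence of polynomials is a witness for
     [D0]. *)
  exists (fun _ => q); split.
    move=> P /uniform_nbhs[E [entE subP]]; exists 0%N => // n _; apply: subP => y /=.
    rewrite in_itv /= => /andP[y0 _]; rewrite fq//; exact: entourage_refl.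
  have -> : (fun k j => opmx_horner B q k j - D0 k j) = (fun _ _ => 0).
    apply/funext => k; apply/funext => j.
    rewrite opmx_horner_quasi_idem /D0 -fq// f0 -fq ?ltW// subr0 rmorph0 mul0r.
    by rewrite add0r subrr.
  by rewrite opnorm0; exact: cvg_cst.
(* [funcalc] picks some operator with the defining property; it remains to show that any such
   operator equals [D0]. *)
rewrite /funcalc; have /= : [set D | is_funcalc f B D] (xget (fun _ _ => 0) [set D | is_funcalc f B D]).
  by apply: xgetPex; exists D0.
move: (xget _ _) => D [bD [qn [qf qD]]].
apply/funext => k; apply/funext => j; apply/eqP; rewrite -subr_eq0; apply/eqP.
apply: ComplexField.Normc.eq0_normc.
have ptw x : 0 <= x <= fine (opnorm B) -> (qn n).[x] @[n --> \oo] --> f x.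
  move=> xB; have sub : [set x] `<=` `[0, fine (opnorm B)].
    by move=> _ ->; rewrite /= in_itv.
  have : {uniform [set x], (fun n t => (qn n).[t]) @ \oo --> f}.
    by apply: uniform_subset_cvg qf.
  by rewrite uniform_set1.
have q0 : (qn n).[0] @[n --> \oo] --> (0 : R).
  by rewrite -[X in _ --> X]f0; apply: ptw; rewrite lexx (le_trans (ltW c0)).
have qc : (qn n).[c] @[n --> \oo] --> f c by apply: ptw; rewrite ltW.
set d := fun n => opmx_horner B (qn n) k j - D k j.
(* The left-hand side does not depend on [n], while all three terms on the right tend to 0. *)
have dE n : D k j - D0 k j = - d n + ((qn n).[0])%:C%C * (k == j)%:R
    + (((qn n).[c] - (qn n).[0]) / c - f c / c)%:C%C * B k j.
  rewrite /d opmx_horner_quasi_idem /D0 !rmorphB /=; ring.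
have db n : cabs (D k j - D0 k j) <= fine (cabs (d n))%:E
    + (`|(qn n).[0]| + `|((qn n).[c] - (qn n).[0]) / c - f c / c| * cabs (B k j)).
  have cabsR (x : R) : cabs x%:C%C = `|x|.
    by rewrite /cabs /= expr0n addr0 sqrtr_sqr.
  rewrite (dE n) addrA (le_trans (le_normcD _ _))// lerD//; last first.
    by rewrite ComplexField.Normc.normcM cabsR.
  rewrite (le_trans (le_normcD _ _))// lerD ?normcN//.
  rewrite ComplexField.Normc.normcM cabsR ler_piMr//.
  by case: eqP => _; rewrite (ComplexField.Normc.normc0, ComplexField.Normc.normc1).
have d0 : fine (cabs (d n))%:E @[n --> \oo] --> (0 : R).
  apply: (@fine_cvg _ _ _ _ (fun n => (cabs (d n))%:E)).
  apply: (@squeeze_cvge _ _ _ _ (fun=> 0%E) _ _ _ _ _ qD); last exact: cvg_cst.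
  apply: nearW => n; rewrite lee_fin cabs_ge0 /=.
  exact: (cabs_le_opnorm (fun k j => opmx_horner B (qn n) k j - D k j)).
have nq : `|(qn n).[0]| @[n --> \oo] --> (0 : R).
  by rewrite -[X in _ --> X](@normr0 _ R); apply: cvg_norm.
have nd : `|((qn n).[c] - (qn n).[0]) / c - f c / c| * cabs (B k j)
    @[n --> \oo] --> (0 : R).
  rewrite -[X in _ --> X](mul0r (cabs (B k j))).
  apply: cvgM; last exact: cvg_cst.
  rewrite -[X in _ --> X](@normr0 _ R); apply: cvg_norm.
  rewrite -[X in _ --> X](subrr (f c / c)).
  apply: cvgB; last exact: cvg_cst.
  apply: cvgM; last exact: cvg_cst.
  by rewrite -[X in _ --> X]subr0; exact: cvgB.
have sum0 := cvgD d0 (cvgD nq nd).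
apply/eqP; rewrite eq_le cabs_ge0 andbT.
have -> : (0 : R) = 0 + (0 + 0) by rewrite !addr0.
by apply: (cvgr_to_ge (sum0 _ _)); exact: nearW.
Qed.
End FunctionalCalculus.

(** * Schatten norms of real matrices with A A^* A = c A, for even exponents *)

Section RealSchatten.
Variable R : realType.
Local Notation C := R[i].

Definition real_op (a : int -> int -> R) : opmx R := fun k j => (a k j)%:C%C.

Variables (s t : seq int) (a : int -> int -> R) (c : R).
Hypotheses (us : uniq s) (ut : uniq t).
Hypothesis sa : forall k j, ~~ ((k \in s) && (j \in t)) -> a k j = 0.
Hypothesis c0 : 0 < c.
(* A A^* A = c A, so that A^* A is c times a projection. *)
Hypothesis aaa : forall k l,
  \sum_(i <- s) \sum_(j <- t) a k j * a i j * a i l = c * a k l.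
Hypothesis an0 : exists k j, a k j != 0.

Lemma supported_real_op : supported s t (real_op a).
Proof. by move=> k j kj; rewrite /real_op sa. Qed.

Let B := opmx_mul (opmx_adj (real_op a)) (real_op a).

Lemma gram_real_opE k j : B k j = (\sum_(i <- s) a i k * a i j)%:C%C.
Proof.
rewrite /B /opmx_mul (@csum_finsupp _ s)//.
  rewrite rmorph_sum /=; apply: eq_bigr => i _.
  by rewrite /opmx_adj /real_op conjc_real rmorphM.
by move=> i si; rewrite /real_op (@sa i j) ?rmorph0 ?mulr0// (negbTE si).
Qed.

(** For p = 2(r + 1) the function x^(p/2) is the polynomial x^(r+1) on x >= 0, and its value at c
    divided by c is c^r. *)
Lemma funcalc_gram_real_op (p : R) (r : nat) : p / 2 = r.+1%:R ->
  funcalc (fun x => x `^ (p / 2)) B = fun k j => (c ^+ r)%:C%C * B k j.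
Proof.
move=> pr.
rewrite (@funcalc_quasi_idem R t B c ut _ c0 _ _ _ 'X^(r.+1)).
- apply/funext => k; apply/funext => j; rewrite pr powR_mulrn ?ltW//.
  by rewrite exprSr mulfK ?gt_eqF.
- move=> k j kj; rewrite gram_real_opE big1// => i _.
  have [kt|kt] := boolP (k \in t); last by rewrite (@sa i k) ?mul0r// (negbTE kt) andbF.
  by rewrite (@sa i j) ?mulr0//; move: kj; rewrite kt /= => /negbTE ->; rewrite andbF.
(* A^* A A^* A = A^* (A A^* A) = c A^* A. *)
- move=> k j; under eq_bigr do rewrite !gram_real_opE -rmorphM.
  rewrite gram_real_opE -rmorph_sum -rmorphM; congr (_%:C%C).
  under eq_bigr do rewrite mulr_suml.
  rewrite exchange_big /= mulr_sumr; apply: eq_bigr => i _.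
  rewrite mulrCA -aaa exchange_big /= mulr_sumr; apply: eq_bigr => l _.
  by rewrite -mulrA !mulr_sumr; apply: eq_bigr => i' _; ring.
- have [k [j akj]] := an0; exists j, j; rewrite gram_real_opE.
  have /andP[ks jt] : (k \in s) && (j \in t).
    by apply: contraNT akj => /sa ->.
  rewrite -[X in _ != X](rmorph0 (real_complex R)) (inj_eq (@complexI R)).
  rewrite gt_eqF// (big_rem k ks) /= ltr_pwDl//.
    by rewrite -expr2 lt_def sqrf_eq0 akj sqr_ge0.
  by apply: sumr_ge0 => i _; rewrite -expr2 sqr_ge0.
- by move=> x x0; rewrite pr powR_mulrn// hornerXn.
- by rewrite pr powR0.
Qed.

(** The trace of (A^* A)^(r+1) is c^r times the trace of A^* A, and the latter is the sum of the
    squared entries. *)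
Lemma schatten_norm_real_op (p : R) (r : nat) : p / 2 = r.+1%:R ->
  schatten_norm p (real_op a) =
  ((c ^+ r * \sum_(k <- s) \sum_(j <- t) a k j ^+ 2) `^ p^-1)%:E.
Proof.
move=> pr; rewrite /schatten_norm (funcalc_gram_real_op pr) /optrace.
have diagE j : complex.Re ((c ^+ r)%:C%C * B j j)
    = c ^+ r * \sum_(i <- s) a i j ^+ 2.
  rewrite gram_real_opE -rmorphM [LHS]/=.
  by congr (_ * _); apply: eq_bigr => i _; rewrite expr2.
rewrite (@esum_finsupp _ t)//.
- under eq_bigr do rewrite diagE.
  by rewrite sumEFin poweR_EFin -mulr_sumr exchange_big.
- move=> j; rewrite diagE lee_fin mulr_ge0 ?exprn_ge0 ?(ltW c0)//.
  by apply: sumr_ge0 => i _; exact: sqr_ge0.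
- move=> j jt; rewrite diagE big1 ?mulr0// => i _.
  by rewrite (@sa i j) ?expr0n// (negbTE jt) andbF.
Qed.

Lemma schatten_real_op (p : R) (r : nat) : p / 2 = r.+1%:R ->
  schatten p (real_op a).
Proof.
move=> pr; split; first exact: bounded_op_supported us ut supported_real_op.
by rewrite (schatten_norm_real_op pr) ltry.
Qed.
End RealSchatten.

(** * Test matrices for sign symbols, and orthogonality of binary digits *)

Section SignSymbols.
Variable R : realType.
Local Notation C := R[i].

(* For p = 4, compare the sign matrix of sg on s x t with the all-ones matrix,
   onto which the multiplier maps it: the fourth powers of their norms are
   c |s| |t| and (|s| |t|)^2. *)
Lemma schur_sign_bound (sg : int -> int -> R) (s t : seq int) (c K : R)
    (T : opmx R -> opmx R) :
  uniq s -> uniq t -> (0 < size s)%N -> (0 < size t)%N -> 0 < c ->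
  (forall k j, sg k j * sg k j = 1) ->
  (forall k l, k \in s -> l \in t ->
     \sum_(i <- s) \sum_(j <- t) sg k j * sg i j * sg i l = c * sg k l) ->
  (forall A, schatten 4 A ->
     (schatten_norm 4 (T A) <= K%:E * schatten_norm 4 A)%E) ->
  (forall A, schatten 2 A -> schatten 4 A -> T A = schur_mul (real_op sg) A) ->
  (size s)%:R * (size t)%:R <= K ^+ 4 * c.
Proof.
move=> us ut s0 t0 c0 sg2 sg3 TK Tm.
set N := _ * _; have N0 : 0 < N by rewrite mulr_gt0 ?ltr0n.
pose cut (f : int -> int -> R) k j := if (k \in s) && (j \in t) then f k j else 0.
have cut0 f k j : ~~ ((k \in s) && (j \in t)) -> cut f k j = 0.
  by rewrite /cut => /negbTE ->.
have cutE f k j : k \in s -> j \in t -> cut f k j = f k j.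
  by rewrite /cut => -> ->.
have aaa f e : (forall k l, k \in s -> l \in t ->
     \sum_(i <- s) \sum_(j <- t) f k j * f i j * f i l = e * f k l) ->
   forall k l, \sum_(i <- s) \sum_(j <- t) cut f k j * cut f i j * cut f i l
     = e * cut f k l.
  move=> fe k l; have [/andP[ks lt]|kl] := boolP ((k \in s) && (l \in t)).
    rewrite cutE// -fe//; apply: eq_big_seq => i si; apply: eq_big_seq => j jt.
    by rewrite !cutE.
  rewrite [cut f k l]cut0// mulr0 big1_seq// => i /= si; apply: big1_seq => j /= jt.
  have [lt|lt] := boolP (l \in t).
    by rewrite [cut f k j]cut0 ?mul0r// (contra _ kl)// => /andP[->].
  by rewrite [cut f i l]cut0 ?mulr0// (negbTE lt) andbF.
have [k0 k0s] : exists k, k \in s by case: (s) s0 => // k s' _; exists k; exact: mem_head.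
have [j0 j0t] : exists j, j \in t by case: (t) t0 => // j t' _; exists j; exact: mem_head.
have sgn0 k j : sg k j != 0.
  by apply/eqP => e; have := sg2 k j; rewrite e mul0r => /esym/eqP; rewrite oner_eq0.
have cut_sum f : (forall k j, f k j ^+ 2 = 1) ->
    \sum_(k <- s) \sum_(j <- t) cut f k j ^+ 2 = N.
  move=> f1; transitivity (\sum_(k <- s) \sum_(j <- t) (1 : R)).
    by apply: eq_big_seq => k ks; apply: eq_big_seq => j jt; rewrite cutE.
  by rewrite !big_const_seq !count_predT !iter_addr_0 /N mulr_natl.
have sgP := aaa sg c sg3.
have h2 : (2 / 2 : R) = 0.+1%:R by rewrite divff.
have h4 : (4 / 2 : R) = 1.+1%:R by lra.
have sgnz : exists k j, cut sg k j != 0 by exists k0, j0; rewrite cutE.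
(* Membership in S^2 is checked too, since [T] is prescribed to be the multiplier only on the
   intersection of S^2 and S^4. *)
have A2 := schatten_real_op us ut (cut0 sg) c0 sgP sgnz h2.
have A4 := schatten_real_op us ut (cut0 sg) c0 sgP sgnz h4.
have TA : T (real_op (cut sg)) = real_op (cut (fun _ _ => 1)).
  rewrite Tm//; apply/funext => k; apply/funext => j.
  rewrite /schur_mul /real_op -rmorphM /cut; congr (_%:C%C).
  by case: ifP => _; rewrite ?sg2 ?mulr0.
have := TK _ A4; rewrite TA (schatten_norm_real_op us ut (cut0 _) c0 sgP sgnz h4).
(* The all-ones matrix J satisfies J J^* J = |s| |t| J, so its constant is [N]. *)
rewrite (schatten_norm_real_op us ut (cut0 _) N0 _ _ h4); last 2 first.
- apply: aaa => k l ks lt; rewrite [RHS]mulr1 /N.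
  under eq_bigr do under eq_bigr do rewrite !mulr1.
  by rewrite !big_const_seq !count_predT !iter_addr_0 ?mulr1 mulr_natl.
- by exists k0, j0; rewrite cutE ?oner_neq0.
rewrite !cut_sum; try by move=> k j /=; rewrite ?expr1n// expr2 sg2.
rewrite !expr1 -EFinM lee_fin => le1.
(* The sign of [K] is not given, but the right-hand side of [le1] dominates a nonnegative number, so
   fourth powers can be compared. *)
have le2 : ((N * N) `^ 4^-1) ^+ 4 <= (K * (c * N) `^ 4^-1) ^+ 4.
  by rewrite lerXn2r// nnegrE ?powR_ge0// (le_trans _ le1)// powR_ge0.
have pK (x : R) : 0 <= x -> (x `^ 4^-1) ^+ 4 = x.
  by move=> x0; rewrite -powR_mulrn ?powR_ge0// -powRrM mulVf ?powRr1// pnatr_eq0.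
by move: le2; rewrite exprMn !pK ?mulr_ge0 ?(ltW N0) ?(ltW c0)// (mulrA (K ^+ 4)) (ler_pM2r N0).
Qed.

(** Orthogonality of the Rademacher functions, by induction on [d]. The numbers n and n + 2^d with n
    < 2^d agree in the digits below d and differ in digit d: if exactly one of [i], [j] is d the
    terms cancel in pairs, and if both are smaller the sum is twice the preceding one. *)
Lemma sum_sign_bits d i j : (i < d)%N -> (j < d)%N ->
  \sum_(n <- iota 0 (2 ^ d)) (-1) ^+ odd (n %/ 2 ^ i) * (-1) ^+ odd (n %/ 2 ^ j)
  = (2 ^ d)%:R * (i == j)%:R :> R.
Proof.
have bitD d' n l : (l < d')%N -> odd ((n + 2 ^ d') %/ 2 ^ l) = odd (n %/ 2 ^ l).
  move=> ld; rewrite -(subnK ld) addnS -addSn expnD divnDMl ?expn_gt0//.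
  by rewrite oddD oddX addbF.
have bitn d' n : (n < 2 ^ d')%N -> odd (n %/ 2 ^ d') = false.
  by move=> nd; rewrite divn_small.
have bitnD d' n : (n < 2 ^ d')%N -> odd ((n + 2 ^ d') %/ 2 ^ d') = true.
  by move=> nd; rewrite divnDr// divn_small// divnn expn_gt0.
have split d' (f : nat -> R) : \sum_(n <- iota 0 (2 ^ d'.+1)) f n
    = \sum_(n <- iota 0 (2 ^ d')) (f n + f (n + 2 ^ d')%N).
  rewrite expnS mul2n -addnn iotaD big_cat big_split /= add0n; congr (_ + _).
  by rewrite -{1}(add0n (2 ^ d')%N) addnC iotaDl big_map; under eq_bigr do rewrite addnC.
have diag d' : \sum_(n <- iota 0 (2 ^ d')) (1 : R) = (2 ^ d')%:R.
  by rewrite big_const_seq count_predT size_iota iter_addr_0.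
have [<- id _|ij] := eqVneq i j.
  by rewrite mulr1 -diag; apply: eq_bigr => n _; rewrite -signr_addb addbb.
rewrite mulr0; elim: d => // d IH id jd; rewrite split.
have off l : (l < d)%N -> \sum_(n <- iota 0 (2 ^ d))
   ((-1) ^+ odd (n %/ 2 ^ l) * (-1) ^+ odd (n %/ 2 ^ d)
    + (-1) ^+ odd ((n + 2 ^ d) %/ 2 ^ l) * (-1) ^+ odd ((n + 2 ^ d) %/ 2 ^ d))
   = 0 :> R.
  move=> ld; rewrite big1_seq// => n /=; rewrite mem_iota add0n => nd.
  by rewrite (bitD _ _ _ ld) (bitn _ _ nd) (bitnD _ _ nd) expr0 expr1 mulr1 mulrN1 subrr.
have [di|] := ltnP i d; have [dj|] := ltnP j d.
- under eq_bigr do rewrite !bitD//.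
  by rewrite big_split /= IH// addr0.
- move=> dj; have -> : j = d by apply/eqP; rewrite eqn_leq -ltnS jd.
  exact: off.
- move=> di; have -> : i = d by apply/eqP; rewrite eqn_leq -ltnS id.
  by under eq_bigr do rewrite mulrC [X in _ + X]mulrC; exact: off.
- by move=> dj di; move/eqP: ij => ij; lia.
Qed.
End SignSymbols.

(** * Location of the nonzero digits *)

(* Row 2^e of the symbol carries in column j >= 0 the j-th binary digit of e;
   the other entries are 0. *)
Definition walsh_bit (k j : int) : bool :=
  match k, j with
  | Posz k, Posz j => let e := trunc_log 2 k in (k == 2 ^ e)%N && odd (e %/ 2 ^ j)
  | _, _ => false
  end.

Lemma walsh_bit_pow2 (e j : nat) : walsh_bit (2 ^ e)%N j = odd (e %/ 2 ^ j).
Proof. by rewrite /walsh_bit trunc_expnK// eqxx. Qed.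

(** The exponent 0 has no digit 1, so it may be written e + 1. A digit 1 in position i forces i <
    2^i <= e + 1, hence i <= e < 2^e. *)
Lemma walsh_bitP k j : walsh_bit k j -> exists e i : nat,
  [/\ k = (2 ^ e.+1)%N, j = i & (i < 2 ^ e)%N].
Proof.
case: k => // k; case: j => // i /= /andP[/eqP ke oe].
move: ke oe; case: (trunc_log 2 k) => [|e] ke oe.
  by move: oe; rewrite div0n.
exists e, i; split => //; first by rewrite ke.
have ie : (2 ^ i <= e.+1)%N.
  by rewrite leqNgt; apply: contraL oe => ?; rewrite divn_small.
have := leq_trans (ltn_expl i (isT : (1 < 2)%N)) ie; rewrite ltnS => /leq_ltn_trans; apply.
exact: ltn_expl.
Qed.

(* As j < 2^(e-1), the row 2^e lies at distance between 2^(e-1) and 2^e from j. *)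
Lemma walsh_bit_dyadic n (k j b : int) : (b == 0) || (b == 1) -> dyadic n k ->
  walsh_bit (k + j + b) j ->
  k \in [seq (2 ^ e)%N%:Z - j - b | e <- [:: n.-1; n; n.+1]].
Proof.
move=> b01 /andP[kn nk] /walsh_bitP[e [i [ke ji ie]]].
suff : e.+1 \in [:: n.-1; n; n.+1].
  move=> en; apply/mapP; exists e.+1 => //; rewrite -ke; lia.
have e2 : (2 ^ e.+1 = 2 ^ e + 2 ^ e)%N by rewrite expnS mul2n addnn.
(* Here k = 2^(e+1) - i - b with i < 2^e and b <= 1, so 2^e <= k <= 2^(e+1); this is compared with
   2^(n-1) <= |k| < 2^n. *)
have en : (e.+1 <= n.+1)%N.
  rewrite -(@leq_exp2l 2)// e2; move: (expnS 2 n); lia.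
have ne : (n.-1 <= e.+1)%N.
  by rewrite -(@leq_exp2l 2)//; lia.
rewrite !inE; lia.
Qed.

(** * Bounded variation of the digit symbol and its unboundedness on S^4 *)

Section Symbol.
Variable R : realType.

Definition walsh_sign (k j : int) : R := (-1) ^+ walsh_bit k j.

(** A term vanishes unless row k + j or row k + j + 1 carries a digit 1 in column [j]. Two shifts
    and three exponents leave at most six values of k, each contributing at most 2, so the sum is at
    most 12. *)
Lemma walsh_sign_variation n j : \sum_(k \in dyadic n)
  cabs ((walsh_sign (k + j + 1) j)%:C%C - (walsh_sign (k + j) j)%:C%C) < 13.
Proof.
set f := fun k : int => _.
pose S := [seq (2 ^ e)%N%:Z - j - b | b <- [:: 0; 1], e <- [:: n.-1; n; n.+1]].
pose r := [seq k <- undup S | k \in dyadic n].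
have f2 k : f k <= 2.
  rewrite /f -rmorphB /= expr0n addr0 sqrtr_sqr (le_trans (ler_normB _ _))//.
  by rewrite /walsh_sign !normrX !normrN !normr1 !expr1n.
rewrite (fsbigE r); last 3 first.
- exact/filter_uniq/undup_uniq.
- by move=> k /=; rewrite mem_filter => /andP[/set_mem].
- move=> k kn; rewrite mem_filter mem_undup mem_set//= => kS.
  have bF b : b \in [:: 0; 1] -> walsh_bit (k + j + b) j = false.
    move=> b01; apply: contraNF kS => kb.
    have b01' : (b == 0) || (b == 1) by rewrite !inE in b01.
    have /mapP[e en ->] := walsh_bit_dyadic b01' kn kb.
    by apply/allpairsP; exists (b, e).
  have b0 := bF 0 isT; have b1 := bF 1 isT; rewrite addr0 in b0.
  by rewrite /f /walsh_sign b0 b1 !subrr expr0n addr0 sqrtr0.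
apply: (@le_lt_trans _ _ (\sum_(k <- r | k \in dyadic n) 2)).
  by apply: ler_sum => k _; exact: f2.
apply: (@le_lt_trans _ _ (\sum_(k <- r) 2)).
  rewrite [X in X <= _]big_mkcond /=; apply: ler_sum => k _; by case: ifP.
rewrite big_const_seq count_predT iter_addr_0.
have : (size r <= 6)%N.
  rewrite size_filter (leq_trans (count_size _ _))//.
  by rewrite (leq_trans (size_undup _))// size_allpairs.
by rewrite -mulr_natr -(ler_nat R); lra.
Qed.

Lemma bounded_walsh_sign : bounded_symbol (real_op walsh_sign).
Proof.
exists 1 => k j; rewrite /cabs /= expr0n addr0 sqrtr_sqr.
by rewrite normrX normrN normr1 expr1n.
Qed.

(** The exponents n < 2^d run through all binary words of length d; the columns below are the digit
    positions. *)
Definition walsh_rows d : seq int := [seq (2 ^ n)%N%:Z | n <- iota 0 (2 ^ d)].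
Definition walsh_cols d : seq int := [seq i%:Z | i <- iota 0 d].

Lemma walsh_orthogonal d j l : j \in walsh_cols d -> l \in walsh_cols d ->
  \sum_(i <- walsh_rows d) walsh_sign i j * walsh_sign i l
  = (2 ^ d)%:R * (j == l)%:R.
Proof.
move=> /mapP[j']; rewrite mem_iota => /andP[_ jd] ->.
move=> /mapP[l']; rewrite mem_iota => /andP[_ ld] ->.
rewrite big_map -(sum_sign_bits R jd ld).
by apply: eq_bigr => n _; rewrite /walsh_sign !walsh_bit_pow2.
Qed.

Lemma walsh_rows_uniq d : uniq (walsh_rows d).
Proof. by rewrite map_inj_uniq ?iota_uniq// => m n [] /expnI; apply. Qed.

Lemma walsh_cols_uniq d : uniq (walsh_cols d).
Proof. by rewrite map_inj_uniq ?iota_uniq// => m n []. Qed.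

Lemma walsh_sign_sqr k j : walsh_sign k j * walsh_sign k j = 1.
Proof. by rewrite -signr_addb addbb. Qed.

Lemma walsh_sign_unbounded (T : opmx R -> opmx R) K :
  (forall A, schatten 4 A ->
     (schatten_norm 4 (T A) <= K%:E * schatten_norm 4 A)%E) ->
  ~ (forall A, schatten 2 A -> schatten 4 A ->
      T A = schur_mul (real_op walsh_sign) A) /\
  ~ (forall A, schatten 2 A -> schatten 4 A ->
      T A = schur_mul (real_op (fun k j => walsh_sign j k)) A).
Proof.
move=> TK.
(* Any d > K^4 contradicts the bound 2^d d <= K^4 2^d supplied by the test matrices. *)
pose d := (Num.truncn (K ^+ 4)).+1.
have Kd : K ^+ 4 < d%:R by exact: truncnS_gt.
have c0 : 0 < (2 ^ d)%:R :> R by rewrite ltr0n expn_gt0.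
have sr : size (walsh_rows d) = (2 ^ d)%N by rewrite size_map size_iota.
have sc : size (walsh_cols d) = d by rewrite size_map size_iota.
have r0 : (0 < size (walsh_rows d))%N by rewrite sr expn_gt0.
have k0 : (0 < size (walsh_cols d))%N by rewrite sc.
have absurd : ~ ((2 ^ d)%:R * d%:R <= K ^+ 4 * (2 ^ d)%:R).
  by rewrite mulrC ler_pM2r// leNgt Kd.
have sumD (s : seq int) (F : int -> R) l : uniq s -> l \in s ->
    \sum_(j <- s) F j * (j == l)%:R = F l.
  move=> us ls; rewrite (bigD1_seq l)//= eqxx mulr1 big1 ?addr0// => j /negbTE ->.
  by rewrite mulr0.
split=> Tm; apply: absurd.
- rewrite -{1}sr -{2}sc.
  apply: (schur_sign_bound (walsh_rows_uniq d) (walsh_cols_uniq d) r0 k0 c0 _ _ TK Tm).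
    exact: walsh_sign_sqr.
  (* E E^* E = E (E^* E) = 2^d E: summing over the rows first leaves a Kronecker delta in the
     columns. *)
  move=> k l kr lc; rewrite exchange_big /=.
  rewrite -[RHS](sumD (walsh_cols d) (fun j => (2 ^ d)%:R * walsh_sign k j)) ?walsh_cols_uniq//.
  apply: eq_big_seq => j jc; under eq_bigr do rewrite -mulrA.
  by rewrite -mulr_sumr walsh_orthogonal//; ring.
- rewrite mulrC -{1}sr -{1}sc.
  apply: (schur_sign_bound (walsh_cols_uniq d) (walsh_rows_uniq d) k0 r0 c0 _ _ TK Tm).
    by move=> k j; exact: walsh_sign_sqr.
  (* For the transpose the inner sum already runs over the rows of E, giving (E^* E) E^* = 2^d
     E^*. *)
  move=> k l kc lr.
  rewrite -[RHS](sumD (walsh_cols d) (fun j => (2 ^ d)%:R * walsh_sign l j)) ?walsh_cols_uniq//.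
  apply: eq_big_seq => i ic; rewrite -mulr_suml walsh_orthogonal//.
  by rewrite eq_sym; ring.
Qed.
End Symbol.

Theorem mainTheorem3 (R : realType) :
  ~ (forall m : int -> int -> R[i],
       bounded_symbol m ->
       (exists C : R, forall (n : nat) (j : int),
          \sum_(k \in dyadic n) cabs (m (k + j + 1) j - m (k + j) j) < C) ->
       forall p : R, 1 < p -> schur_extends p m) /\
  ~ (forall m : int -> int -> R[i],
       bounded_symbol m ->
       (exists C : R, forall (n : nat) (j : int),
          \sum_(k \in dyadic n) cabs (m j (k + j + 1) - m j (k + j)) < C) ->
       forall p : R, 1 < p -> schur_extends p m).
Proof.
split=> H.
- have [] := H (real_op (@walsh_sign R)) (@bounded_walsh_sign R) _ 4 _.
  + by exists 13 => n j; exact: walsh_sign_variation.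
  + by rewrite ltr1n.
  + by move=> T [_ _ [K TK]] Tm; exact: (walsh_sign_unbounded TK).1.
- have [] := H (real_op (fun k j => walsh_sign R j k)) _ _ 4 _.
  + by have [M hM] := @bounded_walsh_sign R; exists M => k j; exact: hM.
  + by exists 13 => n j; exact: walsh_sign_variation.
  + by rewrite ltr1n.
  + by move=> T [_ _ [K TK]] Tm; exact: (walsh_sign_unbounded TK).2.
Qed.
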